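(* Let $\mathfrak g$ be a restricted Lie algebra over $\mathbb F$, and let $\mathfrak h$ be a restricted $\mathfrak g$-module, regarded as a strongly abelian restricted Lie algebra. Then the set of equivalence classes of restricted extensions of $\mathfrak g$ by $\mathfrak h$ (inducing the given $\mathfrak g$-module structure on $\mathfrak h$) is in one-to-one correspondence with $H^2(\mathfrak g;\mathfrak h)$.
   Context: $\mathbb F$ is a field of characteristic $p>0$. Left-normed brackets: $[g_1,g_2,\dots,g_k]=[[\cdots[[g_1,g_2],g_3]\cdots],g_k]$ (with $[g_1]=g_1$). A restricted Lie algebra is a Lie algebra $\mathfrak g$ over $\mathbb F$ with a map $g\mapsto g^{[p]}$ such that $(\lambda g)^{[p]}=\lambda^pg^{[p]}$; $(g+h)^{[p]}=g^{[p]}+h^{[p]}+\sum\frac1{\#(g)}[g_1,\dots,g_p]$, the sum over words $(g_1,\dots,g_p)$ in the letters $g,h$ with $g_1=g$, $g_2=h$, where $\#(g)$ is the number of letters $g$ in the word; and $[g,h^{[p]}]=[g,h,\dots,h]$ ($p$ copies of $h$). Homomorphisms of restricted Lie algebras are Lie homomorphisms commuting with the $p$-operators. A restricted $\mathfrak g$-module is a $\mathfrak g$-module $M$ with $g^{[p]}x=g^px$ for all $g,x$. A restricted Lie algebra $\mathfrak h$ is strongly abelian if $[\mathfrak h,\mathfrak h]=0$ and $\mathfrak h^{[p]}=0$. A restricted extension of $\mathfrak g$ by a strongly abelian $\mathfrak h$ is an exact sequence $0\to\mathfrak h\to\mathfrak e\xrightarrow{\pi}\mathfrak g\to0$ of restricted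 Lie algebras and their homomorphisms. It makes $\mathfrak h$ a restricted $\mathfrak g$-module by $g\cdot h=[\tilde g,h]$ for any $\tilde g\in\mathfrak e$ with $\pi(\tilde g)=g$. Two extensions $\mathfrak e_1,\mathfrak e_2$ are equivalent if there is a restricted Lie algebra isomorphism $\alpha:\mathfrak e_1\to\mathfrak e_2$ fixing $\mathfrak h$ elementwise with $\pi_2\alpha=\pi_1$. Cohomology: for a restricted $\mathfrak g$-module $M$, let $C^q_{\rm cl.}(\mathfrak g;M)=\operatorname{Hom}_{\mathbb F}(\Lambda^q\mathfrak g,M)$, $\delta_{\rm cl.}\psi(g,h)=-g\psi(h)+h\psi(g)+\psi([g,h])$ and $\delta_{\rm cl.}\varphi(g,h,f)=\varphi([g,h],f)-\varphi([g,f],h)+\varphi([h,f],g)-g\varphi(h,f)+h\varphi(g,f)-f\varphi(g,h)$. $C^2(\mathfrak g;M)$ is the space of pairs $(\varphi,\omega)$ with $\varphi\in C^2_{\rm cl.}(\mathfrak g;M)$ and $\omega:\mathfrak g\to M$ having the $*$-property with respect to $\varphi$: $\omega(\lambda g)=\lambda^p\omega(g)$ and $$\omega(g+h)=\omega(g)+\omega(h)+\sum_{\substack{g_j=g\text{ or }h\\ g_1=g,\,g_2=h}}\frac1{\#(g)}\sum_{k=0}^{p-2}(-1)^kg_p\cdots g_{p-k+1}\varphi([g_1,\dots,g_{p-k-1}],g_{p-k}).$$ For $\psi\in C^1(\mathfrak g;M)=\operatorname{Hom}_{\mathbb F}(\mathfrak g,M)$, $\delta^1\psi=(\delta_{\rm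 cl.}\psi,\tilde\psi)$ with $\tilde\psi(g)=\psi(g^{[p]})-g^{p-1}\psi(g)$. For $(\varphi,\omega)\in C^2(\mathfrak g;M)$, $\delta^2(\varphi,\omega)=(\delta_{\rm cl.}\varphi,\beta)$ with $$\beta(g,h)=\varphi(g,h^{[p]})-\sum_{i+j=p-1}(-1)^ih^i\varphi([g,\underbrace{h,\dots,h}_j],h)+g\,\omega(h).$$ $H^2(\mathfrak g;M)=\ker\delta^2/\operatorname{im}\delta^1$. The correspondence meant is the one assigning to an extension the class of $(\varphi,\omega)$, where $\varphi(g,g')=[\sigma(g),\sigma(g')]-\sigma([g,g'])$, $\omega(g)=\sigma(g)^{[p]}-\sigma(g^{[p]})$ and $\sigma:\mathfrak g\to\mathfrak e$ is any $\mathbb F$-linear map with $\pi\sigma=1_{\mathfrak g}$. *)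

(* Defs.v *)
From HB Require Import structures.
From mathcomp Require Import all_boot all_order all_algebra.
From mathcomp Require Import classical_sets functions.

Set Implicit Arguments.
Unset Strict Implicit.
Unset Printing Implicit Defensive.

Import GRing.Theory.
Local Open Scope ring_scope.
Local Open Scope classical_set_scope.

HB.mixin Record Lmodule_isLie (F : fieldType) (L : Type) of GRing.Lmodule F L := {
  bracket : L -> L -> L;
  bracket_linearl : forall z, linear (bracket^~ z);
  bracket_linearr : forall z, linear (bracket z);
  bracketxx : forall x, bracket x x = 0;
  bracket_jacobi : forall x y z,
    bracket (bracket x y) z + bracket (bracket y z) x
      + bracket (bracket z x) y = 0
}.

#[short(type="lieType")]
HB.structure Definition Lie (F : fieldType) :=
  {L of Lmodule_isLie F L & GRing.Lmodule F L}.

(* Left-normed bracket [[..[[g_1, g_2], g_3]..], g_k] of a sequence. *)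
Definition lbracket (F : fieldType) (L : lieType F) (s : seq L) : L :=
  if s is x :: s' then foldl bracket x s' else 0.

(* A word (g_1, .., g_p) in two letters g, h is encoded by a p-tuple of
   booleans, true standing for g and false for h, so that the words are formal:
   they are not identified when g and h happen to be the same element.
   The relevant words are those with g_1 = g and g_2 = h. *)
Definition gh_word (p : nat) (w : p.-tuple bool) : bool :=
  nth false w 0 && ~~ nth true w 1.

Definition spell (T : Type) (g h : T) (w : seq bool) : seq T :=
  [seq (if b then g else h) | b <- w].

HB.mixin Record Lie_isRestricted (F : fieldType) (p : nat) (L : Type)
    of Lie F L := {
  pmap : L -> L;
  pmapZ : forall (a : F) (x : L), pmap (a *: x) = a ^+ p *: pmap x;
  pmapD : forall x y : L,
    pmap (x + y) = pmap x + pmap y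
      + \sum_(w : p.-tuple bool | gh_word w)
          (count id w)%:R^-1 *: lbracket (spell x y w);
  bracket_pmap : forall x y : L,
    bracket x (pmap y) = lbracket (x :: nseq p y)
}.

#[short(type="restrictedLieType")]
HB.structure Definition RestrictedLie (F : fieldType) (p : nat) :=
  {L of Lie_isRestricted F p L & Lie F L}.

Definition restricted_hom (F : fieldType) (p : nat)
    (L L' : restrictedLieType F p) (f : L -> L') : Prop :=
  [/\ linear f,
      forall x y, f (bracket x y) = bracket (f x) (f y)
    & forall x, f (pmap x) = pmap (f x)].

Definition strongly_abelian (F : fieldType) (p : nat)
    (L : restrictedLieType F p) : Prop :=
  (forall x y : L, bracket x y = 0) /\ (forall x : L, pmap x = 0).

Record restricted_module (F : fieldType) (p : nat)
    (g : restrictedLieType F p) (M : lmodType F) := RestrictedModule {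
  act :> g -> M -> M;
  act_linearl : forall m, linear (act^~ m);
  act_linearr : forall x, linear (act x);
  act_bracket : forall x y m,
    act (bracket x y) m = act x (act y m) - act y (act x m);
  act_pmap : forall x m, act (pmap x) m = iter p (act x) m
}.

Section Cohomology.
Variables (F : fieldType) (p : nat) (g : restrictedLieType F p).
Variables (M : lmodType F) (rho : restricted_module g M).

(* Hom(Lambda^2 g, M) is identified with the alternating bilinear maps. *)
Definition alternating2 (phi : g -> g -> M) : Prop :=
  [/\ forall y, linear (phi^~ y),
      forall x, linear (phi x)
    & forall x, phi x x = 0].

(* With s = (g_1, .., g_p), the k-th summand is
   (-1)^k g_p .. g_{p-k+1} phi([g_1, .., g_{p-k-1}], g_{p-k});
   s`_i is g_{i+1}, and foldl makes g_{p-k+1} act first and g_p last. *)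
Definition star_sum (phi : g -> g -> M) (s : seq g) : M :=
  \sum_(k < p.-1) (-1) ^+ k *:
    foldl (fun m x => rho x m)
          (phi (lbracket (take (p - k.+1) s)) s`_(p - k.+1))
          (drop (p - k) s).

Definition star_property (phi : g -> g -> M) (omega : g -> M) : Prop :=
  (forall (a : F) x, omega (a *: x) = a ^+ p *: omega x) /\
  (forall x y, omega (x + y) = omega x + omega y
     + \sum_(w : p.-tuple bool | gh_word w)
         (count id w)%:R^-1 *: star_sum phi (spell x y w)).

Definition delta_cl1 (psi : g -> M) (x y : g) : M :=
  - rho x (psi y) + rho y (psi x) + psi (bracket x y).

Definition delta_cl2 (phi : g -> g -> M) (x y z : g) : M :=
  phi (bracket x y) z - phi (bracket x z) y + phi (bracket y z) x
  - rho x (phi y z) + rho y (phi x z) - rho z (phi x y).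

(* All pairs of maps (phi, omega); C2 below is the cochain space proper. *)
Definition precochain2 : Type := ((g -> g -> M) * (g -> M))%type.

Definition C2 : set precochain2 :=
  [set c | alternating2 c.1 /\ star_property c.1 c.2].

Definition delta1 (psi : g -> M) : precochain2 :=
  (delta_cl1 psi, fun x => psi (pmap x) - iter p.-1 (rho x) (psi x)).

Definition beta (phi : g -> g -> M) (omega : g -> M) (x y : g) : M :=
  phi x (pmap y)
  - \sum_(i < p) (-1) ^+ i *:
      iter i (rho y) (phi (lbracket (x :: nseq (p.-1 - i) y)) y)
  + rho x (omega y).

Definition delta2 (c : precochain2) :
    (g -> g -> g -> M) * (g -> g -> M) :=
  (delta_cl2 c.1, beta c.1 c.2).

Definition Z2 : set precochain2 := [set c | C2 c /\ delta2 c = 0].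

Definition B2 : set precochain2 :=
  [set delta1 psi | psi in [set psi : g -> M | linear psi]].

Definition cohomology_class (c : precochain2) : set precochain2 :=
  [set c + b | b in B2].

(* The quotient ker delta^2 / im delta^1, as the set of cosets. *)
Definition H2 : set (set precochain2) := [set cohomology_class c | c in Z2].

End Cohomology.

Section Extensions.
Variables (F : fieldType) (p : nat) (g h : restrictedLieType F p).
Variable rho : restricted_module g h.

(* Restricted extensions 0 -> h -> e -> g -> 0 inducing the action rho. Since
   ext_pi is surjective, ext_act says that rho x m = [x~, m] for every x and
   every lift x~ of x. *)
Record extension := Extension {
  ext_alg :> restrictedLieType F p;
  ext_iota : h -> ext_alg;
  ext_pi : ext_alg -> g;
  ext_iota_hom : restricted_hom ext_iota;
  ext_pi_hom : restricted_hom ext_pi;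
  ext_iota_inj : injective ext_iota;
  ext_exact : forall e, ext_pi e = 0 <-> exists m, ext_iota m = e;
  ext_pi_surj : forall x, exists e, ext_pi e = x;
  ext_act : forall e m, bracket e (ext_iota m) = ext_iota (rho (ext_pi e) m)
}.

Definition ext_equiv (E1 E2 : extension) : Prop :=
  exists alpha : E1 -> E2,
    [/\ restricted_hom alpha, bijective alpha,
        forall m, alpha (ext_iota E1 m) = ext_iota E2 m
      & forall e, ext_pi (alpha e) = ext_pi e].

Definition ext_class (E : extension) : set extension := [set E' | ext_equiv E E'].

Definition ext_classes : set (set extension) := range ext_class.

Definition ext_section (E : extension) (sigma : g -> E) : Prop :=
  linear sigma /\ cancel sigma (@ext_pi E).

(* c = (phi, omega) is the cochain of sigma; h is seen inside E via ext_iota. *)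
Definition ext_cochain (E : extension) (sigma : g -> E) (c : precochain2 g h) : Prop :=
  (forall x y, ext_iota E (c.1 x y)
     = bracket (sigma x) (sigma y) - sigma (bracket x y)) /\
  (forall x, ext_iota E (c.2 x) = pmap (sigma x) - sigma (pmap x)).

End Extensions.

Arguments ext_classes {F p g h} rho.

(* Main.v *)
(* A linear section sigma of an extension E splits E as h + g, and (phi, omega)
   records how far sigma is from being a homomorphism: the axioms of E translate
   into delta^2 (phi, omega) = 0 and the *-property, and replacing sigma by
   sigma - psi adds delta^1 psi. Conversely a cocycle twists the bracket and the
   p-map of h + g. The part of the axioms for the p-map that does not involve
   the cocycle, i.e. the case of the semidirect product, follows from Jacobson's
   formula for p-th powers in an associative ring, because (m, x) acts on
   h + F as the affine matrix [[x, m], [0, 0]]. *)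
Require Import Defs.
From HB Require Import structures.
From mathcomp Require Import all_boot all_order all_algebra.
From mathcomp Require Import classical_sets functions boolp.

Set Implicit Arguments.
Unset Strict Implicit.
Unset Printing Implicit Defensive.

Import GRing.Theory.
Local Open Scope ring_scope.

(** * Jacobson's formula for p-th powers *)

(** The alternating sums in the star property and in [beta] are one quantity, [bracket_defect], on
    words of length p and p + 1. It is determined by a recursion on the last letter, which holds
    both for a section of an extension and for the kernel component of a twisted algebra. This
    single recursion therefore serves both directions of the correspondence.

    The ring [endo V] of additive endomorphisms has two uses: on a ring A, where bracketing with b
    is a difference of two commuting multiplications, and on h + F, where affine matrices live. It
    carries no F-algebra structure; Jacobson's formula only needs p = 0 in it.

    The bijection is defined without choosing a section: a class goes to the set of all cochains of
    all linear sections of all its members. Since g may have infinite dimension, linear sections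
    come from Zorn's lemma. *)

Record endo (V : zmodType) := Endo {
  endo_fun :> V -> V;
  endo_subproof : {morph endo_fun : u v / u - v}
}.

Section EndoRing.
Context {V : zmodType}.
Implicit Types a b c : endo V.

HB.instance Definition _ a :=
  GRing.isZmodMorphism.Build V V (endo_fun a) (endo_subproof a).

Lemma endoP a b : (forall u, a u = b u) -> a = b.
Proof.
case: a b => f Hf [f' Hf'] /= /funext eq_f.
by subst f'; congr Endo; exact: Prop_irrelevance.
Qed.

HB.instance Definition _ := gen_eqMixin (endo V).
HB.instance Definition _ := gen_choiceMixin (endo V).

Program Definition endo_zero := @Endo V (fun=> 0) _.
Next Obligation. by move=> u v; rewrite subr0. Qed.
Program Definition endo_opp a := @Endo V (fun u => - a u) _.
Next Obligation. by move=> /= u v; rewrite raddfB opprB opprK addrC. Qed.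
Program Definition endo_add a b := @Endo V (fun u => a u + b u) _.
Next Obligation. by move=> /= u v; rewrite !raddfB addrACA opprD. Qed.
Definition endo_one := @Endo V id (fun u v => erefl).
Program Definition endo_mul a b := @Endo V (fun u => a (b u)) _.
Next Obligation. by move=> /= u v; rewrite !raddfB. Qed.

Fact endo_addA : associative endo_add.
Proof. by move=> a b c; apply: endoP => u /=; rewrite addrA. Qed.
Fact endo_addC : commutative endo_add.
Proof. by move=> a b; apply: endoP => u /=; rewrite addrC. Qed.
Fact endo_add0 : left_id endo_zero endo_add.
Proof. by move=> a; apply: endoP => u /=; rewrite add0r. Qed.
Fact endo_addN : left_inverse endo_zero endo_opp endo_add.
Proof. by move=> a; apply: endoP => u /=; rewrite addNr. Qed.

HB.instance Definition _ := GRing.isZmodule.Build (endo V)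
  endo_addA endo_addC endo_add0 endo_addN.

Fact endo_mulA : associative endo_mul.
Proof. by move=> a b c; apply: endoP. Qed.
Fact endo_mul1 : left_id endo_one endo_mul.
Proof. by move=> a; apply: endoP. Qed.
Fact endo_mulr1 : right_id endo_one endo_mul.
Proof. by move=> a; apply: endoP. Qed.
Fact endo_mulDl : left_distributive endo_mul +%R.
Proof. by move=> a b c; apply: endoP. Qed.
Fact endo_mulDr : right_distributive endo_mul +%R.
Proof. by move=> a b c; apply: endoP => u /=; rewrite raddfD. Qed.

HB.instance Definition _ := GRing.Zmodule_isPzRing.Build (endo V)
  endo_mulA endo_mul1 endo_mulr1 endo_mulDl endo_mulDr.

Definition endo_eval (u : V) (a : endo V) : V := a u.
Fact endo_eval_is_zmod_morphism u : zmod_morphism (endo_eval u).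
Proof. by []. Qed.
HB.instance Definition _ u :=
  GRing.isZmodMorphism.Build _ _ (endo_eval u) (endo_eval_is_zmod_morphism u).

Lemma endo_mulE a b u : (a * b) u = a (b u).
Proof. by []. Qed.

Lemma endo_exprE a n u : (a ^+ n) u = iter n a u.
Proof. by elim: n => //= n <-; rewrite exprS. Qed.

End EndoRing.

(** * Iterated commutators in characteristic p *)

Definition commutator {A : pzRingType} (a b : A) : A := a * b - b * a.

Section Commutators.
Variable A : pzRingType.
Implicit Types a b : A.

Fact lmul_subproof b : {morph ( *%R b) : u v / u - v}.
Proof. by move=> u v; rewrite mulrBr. Qed.
Fact rmul_subproof b : {morph ( *%R^~ b) : u v / u - v}.
Proof. by move=> u v; rewrite mulrBl. Qed.
Definition lmul b : endo A := Endo (lmul_subproof b).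
Definition rmul b : endo A := Endo (rmul_subproof b).

Lemma foldl_commutator_nseq n a b :
  foldl commutator a (nseq n b) = ((rmul b - lmul b) ^+ n) a.
Proof.
rewrite endo_exprE; elim: n a => // n IHn a.
by rewrite iterSr -IHn.
Qed.

Lemma iter_lmul n a b : iter n (lmul b) a = b ^+ n * a.
Proof. by elim: n => [|n IHn]; rewrite ?mul1r //= IHn mulrA -exprS. Qed.

Lemma iter_rmul n a b : iter n (rmul b) a = a * b ^+ n.
Proof. by elim: n => [|n IHn]; rewrite ?mulr1 //= IHn -mulrA -exprSr. Qed.

(** By Pascal's rule neighbouring entries of row p - 1 add up to C(p, i + 1), which p divides. *)
Lemma bin_pred_prime p : prime p -> p%:R = 0 :> A ->
  forall i, (i < p)%N -> 'C(p.-1, i)%:R = (-1) ^+ i :> A.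
Proof.
move=> p_pr p0; elim=> [|i IHi] ltip; first by rewrite bin0.
have : 'C(p.-1.+1, i.+1)%:R = 0 :> A.
  rewrite prednK ?prime_gt0 //.
  have /dvdnP[k ->] : (p %| 'C(p, i.+1))%N by rewrite prime_dvd_bin.
  by rewrite natrM p0 mulr0.
rewrite binS natrD IHi ?(ltnW ltip) // exprS mulN1r => /eqP.
by rewrite addr_eq0 => /eqP.
Qed.

(** [rmul b] and [lmul b] commute, so the binomial theorem applies to their difference; each
    binomial coefficient cancels the sign of its term. *)
Lemma ad_pred_prime p a b : prime p -> p%:R = 0 :> A ->
  foldl commutator a (nseq p.-1 b) = \sum_(i < p) b ^+ i * a * b ^+ (p.-1 - i).
Proof.
move=> p_pr p0; rewrite foldl_commutator_nseq exprBn_comm; last first.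
  by apply: endoP => u /=; rewrite mulrA.
rewrite -[LHS]/(endo_eval a _) raddf_sum prednK ?prime_gt0 //.
apply: eq_bigr => i _; rewrite raddfMn /= /endo_eval.
have sign_endo u : ((-1) ^+ i : endo A) u = (-1) ^+ i * u.
  rewrite -signr_odd -[in RHS]signr_odd.
  by case: (odd i); rewrite ?expr0 ?expr1 ?mul1r ?mulN1r.
rewrite sign_endo -mulrnAl -mulr_natr bin_pred_prime // -expr2 sqrr_sign mul1r.
by rewrite !endo_exprE iter_lmul iter_rmul.
Qed.

Lemma commutator_expr_prime p a b : prime p -> p%:R = 0 :> A ->
  foldl commutator a (nseq p b) = commutator a (b ^+ p).
Proof.
move=> p_pr p0; have p_gt0 := prime_gt0 p_pr.
rewrite -{1}(prednK p_gt0) -addn1 nseqD foldl_cat ad_pred_prime //=.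
rewrite /commutator mulr_sumr mulr_suml -sumrB -(prednK p_gt0) /=.
(* The i-th term times b on the right is - f i, and b times it is - f (i + 1), so the sum
   telescopes. *)
pose f i := - (b ^+ i * a * b ^+ (p.-1.+1 - i)).
rewrite (eq_bigr (fun i : 'I_p.-1.+1 => f i.+1 - f i)) => [|i _]; last first.
  rewrite /f opprK addrC subSS !mulrA -exprS -[_ * b]mulrA -exprSr -subSn //.
  by rewrite -ltnS.
rewrite -(big_mkord xpredT (fun i => f i.+1 - f i)) telescope_sumr // /f.
by rewrite subnn subn0 !expr0 mulr1 mul1r opprK addrC.
Qed.

End Commutators.

Lemma sum_tuple_bool_cons (V : nmodType) n (G : seq bool -> V) :
  \sum_(w : n.+1.-tuple bool) G w =
  \sum_(w : n.-tuple bool) (G (true :: w) + G (false :: w)).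
Proof.
rewrite (reindex (fun bw : bool * n.-tuple bool => [tuple of bw.1 :: bw.2])) /=.
  rewrite -(pair_big xpredT xpredT
    (fun b (w : n.-tuple bool) => G (b :: w))) /=.
  by rewrite big_bool big_split.
exists (fun w => (thead w, [tuple of behead w])) => [[b w]|w] _ /=.
  by rewrite theadE; congr pair; apply: val_inj.
by case/tupleP: w => b w; apply: val_inj.
Qed.

Section Jacobson.
Variable A : nzRingType.
Implicit Types a b c : A.

(** X is central, so each bracket with a X + b splits into X times a bracket with a, plus a bracket
    with b; the exponent counts the letters a. *)
Lemma foldl_commutator_linear_poly n a b c :
  foldl commutator c%:P (nseq n (a%:P * 'X + b%:P)) =
  \sum_(w : n.-tuple bool)
     foldl commutator c (spell a b w) *: 'X^(count id w).
Proof.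
set P := _ + _; elim: n c => [|n IHn] c /=.
  rewrite (eq_bigr (fun=> c%:P)) => [|w _].
    by rewrite sumr_const card_tuple expn0.
  by rewrite tuple0 /= expr0 alg_polyC.
rewrite (sum_tuple_bool_cons _ (fun w =>
  foldl commutator c (spell a b w) *: 'X^(count id w))) big_split /=.
have -> : commutator c%:P P = (commutator c a)%:P * 'X + (commutator c b)%:P.
  rewrite /commutator /P mulrDl mulrDr !polyCB !polyCM mulrBl -!mulrA.
  by rewrite -['X * c%:P](commr_polyX c%:P) opprD addrACA.
rewrite foldl_commutator_nseq raddfD /= -!foldl_commutator_nseq.
have mulX m u : foldl commutator (u * 'X) (nseq m P)
    = foldl commutator u (nseq m P) * 'X.
  elim: m u => //= m IHm u; rewrite -IHm /commutator mulrBl -!mulrA.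
  by rewrite (commr_polyX P).
rewrite mulX !IHn mulr_suml; congr (_ + _).
by apply: eq_bigr => w _; rewrite add1n exprSr scalerAl.
Qed.

Lemma deriv_exp_comm (P : {poly A}) n :
  (P ^+ n)^`() = \sum_(i < n) P ^+ i * P^`() * P ^+ (n.-1 - i).
Proof.
elim: n => [|n IHn]; first by rewrite big_ord0 expr0 derivC.
rewrite exprSr derivM IHn big_ord_recr /= subnn mulr1 mulr_suml; congr (_ + _).
apply: eq_bigr => i _; rewrite -mulrA -exprSr; congr (_ * P ^+ _).
by case: n i {IHn} => [[]|n i] //=; rewrite subSn // -ltnS.
Qed.

Lemma size_linear_poly a b : (size (a%:P * 'X + b%:P)%R <= 2)%N.
Proof.
rewrite (leq_trans (size_polyD _ _)) // geq_max.
rewrite (leq_trans (size_polyC_leq1 _)) // (leq_trans (size_polyMleq _ _)) //.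
by rewrite size_polyX addn2 ltnS size_polyC_leq1.
Qed.

Lemma size_linear_poly_exp n a b : (size ((a%:P * 'X + b%:P) ^+ n)%R <= n.+1)%N.
Proof.
apply: leq_trans (size_poly_exp_leq _ _) _; rewrite ltnS.
rewrite -[leqRHS]mul1n leq_mul2r -subn1 leq_subLR size_linear_poly.
by rewrite orbT.
Qed.

Lemma coefn_linear_poly_exp n a b : ((a%:P * 'X + b%:P) ^+ n)`_n = a ^+ n.
Proof.
elim: n => [|n IHn]; first by rewrite expr0 coef1.
rewrite exprSr mulrDr mulrA coefD coefMX /= !coefMC IHn exprSr.
by rewrite [_`_n.+1]nth_default ?mul0r ?addr0 ?size_linear_poly_exp.
Qed.

Variable p : nat.
Hypotheses (p_pr : prime p) (p0 : p%:R = 0 :> A).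

(* Differentiating (a X + b)^p gives the sum of the P^i a P^(p-1-i), which is
   (ad P)^(p-1) a in characteristic p. *)
Lemma jacobson_coef a b i : (i < p.-1)%N ->
  ((a%:P * 'X + b%:P) ^+ p)`_i.+1 *+ i.+1 =
  \sum_(w : p.-1.-tuple bool | count id w == i)
     foldl commutator a (spell a b w).
Proof.
move=> ltip; rewrite -coef_deriv deriv_exp_comm.
have -> : (a%:P * 'X + b%:P)^`() = a%:P.
  by rewrite derivMXaddC derivC mul0r addr0.
rewrite -ad_pred_prime -?polyC_natr ?p0 // foldl_commutator_linear_poly.
by rewrite coef_sumMXn.
Qed.

End Jacobson.

Lemma foldl_commutator0 (A : pzRingType) (s : seq A) : foldl commutator 0 s = 0.
Proof. by elim: s => //= c s IHs; rewrite /commutator mul0r mulr0 subrr. Qed.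

Lemma commutatorxx (A : pzRingType) (a : A) : commutator a a = 0.
Proof. exact: subrr. Qed.

(* The formula is transported along an additive map f into a vector space,
   where the coefficients 1/#(g) make sense even if A is not an algebra. *)
Lemma jacobson_formula_nz (F : fieldType) (p : nat) (charFp : p \in [pchar F])
  (A : nzRingType) (V : lmodType F) (f : {additive A -> V}) (a b : A) :
  p%:R = 0 :> A ->
  f ((a + b) ^+ p) = f (a ^+ p) + f (b ^+ p) +
    \sum_(w : p.-tuple bool | gh_word w)
      (count id w)%:R^-1 *: f (foldl commutator a (behead (spell a b w))).
Proof.
move=> p0; have p_pr := pcharf_prime charFp; have p_gt1 := prime_gt1 p_pr.
case: p => // q in charFp p0 p_pr p_gt1 *.
set P := a%:P * 'X + b%:P.
(* So (a + b)^p is the sum of the coefficients of P^p: the extreme ones are b^p and a^p, and those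
   between are known up to a factor i + 1 < p, invertible in F. *)
have P1 : a + b = P.[1] by rewrite !hornerE.
have Pcoef := jacobson_coef p_pr p0 a b; rewrite -/P /= in Pcoef.
have fP (i : 'I_q) : f (P ^+ q.+1)`_i.+1 = i.+1%:R^-1 *:
    \sum_(w : q.-tuple bool | count id w == i)
       f (foldl commutator a (spell a b w)).
  rewrite -raddf_sum -Pcoef // raddfMn -scaler_nat scalerA mulVf ?scale1r //.
  by rewrite -(dvdn_pcharf charFp) gtnNdvd // ltnS.
rewrite P1 -horner_exp_comm; last by rewrite /comm_poly mulr1 mul1r.
rewrite (horner_coef_wide _ (size_linear_poly_exp _ _ _)).
rewrite (eq_bigr (fun i : 'I_q.+2 => (P ^+ q.+1)`_i)) => [|i _]; last first.
  by rewrite expr1n mulr1.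
rewrite big_ord_recl big_ord_recr /= coefn_linear_poly_exp.
rewrite -[(P ^+ _)`_0]horner_coef0 horner_exp_comm; last first.
  by rewrite /comm_poly mulr0 mul0r.
rewrite [P.[0]]hornerMXaddC mulr0 add0r.
rewrite !raddfD /= [LHS]addrCA [LHS]addrC [f (b ^+ _) + _]addrC; congr (_ + _).
(* Here w spells g_2, .., g_p; the omitted first letter a accounts for the +1. Words with g_2 = a
   contribute [a, a] = 0, which is why the sum may be restricted to g_2 = b. *)
pose T (w : seq bool) :=
  (count id w).+1%:R^-1 *: f (foldl commutator a (spell a b w)).
pose G (w : seq bool) := if (nth false w 0 && ~~ nth true w 1)%N
  then (count id w)%:R^-1 *: f (foldl commutator a (behead (spell a b w)))
  else 0.
have T0 w : nth false w 0 -> T w = 0.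
  case: w => [|[] w] //= _; rewrite /T /= commutatorxx foldl_commutator0.
  by rewrite raddf0 scaler0.
transitivity (\sum_(w : q.-tuple bool) T w); last first.
  rewrite [RHS]big_mkcond [RHS](sum_tuple_bool_cons _ G).
  apply: eq_bigr => w _; rewrite /G /= addr0 add1n.
  have -> : nth true w 0 = nth false w 0.
    by apply: set_nth_default; rewrite size_tuple.
  by case: ifPn => // /negPn /T0 ->.
rewrite raddf_sum (eq_bigr _ (fun i _ => fP i)).
transitivity (\sum_(i < q) \sum_(w : q.-tuple bool | count id w == i) T w).
  by apply: eq_bigr => i _; rewrite scaler_sumr; apply: eq_bigr => w /eqP <-.
rewrite (exchange_big_dep xpredT) //=; apply: eq_bigr => w _.
have [ltwq|] := ltnP (count id w) q.
  by rewrite (big_pred1 (Ordinal ltwq)) // => i; rewrite eq_sym.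
(* The word made of q letters a matches no index i < q, but its term vanishes since it begins with
   a. *)
rewrite -[leqLHS](size_tuple w) => lewq.
have /all_nthP/(_ 0)w0 : all id w by rewrite all_count eqn_leq count_size.
have T0w : T w = 0 by apply/T0/w0; rewrite size_tuple.
by rewrite T0w big1.
Qed.

(** The polynomial argument takes place over a nonzero ring; in the zero ring every term
    vanishes. *)
Lemma jacobson_formula (F : fieldType) (p : nat) (charFp : p \in [pchar F])
  (A : pzRingType) (V : lmodType F) (f : {additive A -> V}) (a b : A) :
  p%:R = 0 :> A ->
  f ((a + b) ^+ p) = f (a ^+ p) + f (b ^+ p) +
    \sum_(w : p.-tuple bool | gh_word w)
      (count id w)%:R^-1 *: f (foldl commutator a (behead (spell a b w))).
Proof.
have [A0|A_nz] := eqVneq (1 : A) 0.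
  have zA (c : A) : c = 0 by rewrite -[c]mul1r A0 mul0r.
  rewrite [_ ^+ p]zA [a ^+ p]zA [b ^+ p]zA raddf0 big1 ?addr0 // => w _.
  by rewrite [foldl _ _ _]zA raddf0 scaler0.
pose B : nzRingType := HB.pack_for nzRingType (GRing.PzRing.sort A)
  (GRing.PzSemiRing_isNonZero.Build A A_nz).
exact: (@jacobson_formula_nz F p charFp B V f a b).
Qed.

(** * Words in Lie algebras and cochains *)

HB.instance Definition _ (F : fieldType) (L : lieType F) (x : L) :=
  GRing.isLinear.Build F L L *:%R (bracket x) (bracket_linearr x).

HB.instance Definition _ (F : fieldType) (p : nat) (g : restrictedLieType F p)
    (M : lmodType F) (rho : restricted_module g M) (x : g) :=
  GRing.isLinear.Build F M M *:%R (act rho x) (act_linearr rho x).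

HB.instance Definition _ (F : fieldType) (p : nat) (g h : restrictedLieType F p)
    (rho : restricted_module g h) (E : extension rho) :=
  GRing.isLinear.Build F h E *:%R (ext_iota E)
    (let: And3 lin_iota _ _ := ext_iota_hom E in lin_iota).

HB.instance Definition _ (F : fieldType) (p : nat) (g h : restrictedLieType F p)
    (rho : restricted_module g h) (E : extension rho) :=
  GRing.isLinear.Build F E g *:%R (@ext_pi _ _ _ _ _ E)
    (let: And3 lin_pi _ _ := ext_pi_hom E in lin_pi).

Section LinearFun.
Variables (F : fieldType) (U V : lmodType F) (f : U -> V).
Hypothesis f_linear : linear f.

Definition linear_of : {linear U -> V} :=
  HB.pack f (GRing.isLinear.Build F U V *:%R f f_linear).

Lemma linear_funD u v : f (u + v) = f u + f v.
Proof. exact: (raddfD linear_of). Qed.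

Lemma linear_funN u : f (- u) = - f u.
Proof. exact: (raddfN linear_of). Qed.

Lemma linear_funB u v : f (u - v) = f u - f v.
Proof. exact: (raddfB linear_of). Qed.

Lemma linear_fun0 : f 0 = 0.
Proof. exact: (raddf0 linear_of). Qed.

End LinearFun.

Section LieTheory.
Variables (F : fieldType) (L : lieType F).
Implicit Types x y z : L.

Lemma bracketPl a x y z :
  bracket (a *: x + y) z = a *: bracket x z + bracket y z.
Proof. exact: bracket_linearl. Qed.

Lemma bracketDl x y z : bracket (x + y) z = bracket x z + bracket y z.
Proof. by have := bracket_linearl z 1 x y; rewrite !scale1r. Qed.

Lemma bracketC x y : bracket x y = - bracket y x.
Proof.
have := bracketxx (x + y); rewrite bracketDl !raddfD /= !bracketxx add0r addr0.
by move/eqP; rewrite addr_eq0 => /eqP.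
Qed.

Lemma bracket0l x : bracket 0 x = 0.
Proof. by rewrite bracketC raddf0 oppr0. Qed.

Lemma bracketBl x y z : bracket (x - y) z = bracket x z - bracket y z.
Proof. by rewrite !(bracketC _ z) raddfB opprB opprK addrC. Qed.

Lemma foldl_bracket0 (s : seq L) : foldl bracket 0 s = 0.
Proof. by elim: s => //= x s IHs; rewrite bracket0l. Qed.

Lemma lbracket_rcons x s y :
  lbracket (rcons (x :: s) y) = bracket (lbracket (x :: s)) y.
Proof. by rewrite /lbracket rcons_cons foldl_rcons. Qed.

End LieTheory.

Lemma spell_map (T U : Type) (f : T -> U) (x y : T) w :
  spell (f x) (f y) w = map f (spell x y w).
Proof. by rewrite -map_comp; apply: eq_map => -[]. Qed.

Section ActionTheory.
Variables (F : fieldType) (p : nat) (g : restrictedLieType F p).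
Variables (M : lmodType F) (rho : restricted_module g M).
Implicit Types (x y : g) (m : M).

Lemma actPl a x y m : rho (a *: x + y) m = a *: rho x m + rho y m.
Proof. exact: act_linearl. Qed.

Lemma actDl x y m : rho (x + y) m = rho x m + rho y m.
Proof. by have := actPl 1 x y m; rewrite !scale1r. Qed.

Lemma act0l m : rho 0 m = 0.
Proof. by apply: (addrI (rho 0 m)); rewrite -actDl !addr0. Qed.

Lemma actZl a x m : rho (a *: x) m = a *: rho x m.
Proof. by rewrite -[a *: x]addr0 actPl act0l addr0. Qed.

Lemma iter_act0 k x : iter k (rho x) 0 = 0.
Proof. by elim: k => //= k ->; rewrite raddf0. Qed.

Lemma iter_actN k x m : iter k (rho x) (- m) = - iter k (rho x) m.
Proof. by elim: k => //= k ->; rewrite raddfN. Qed.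

Lemma iter_actZl k a x m : iter k (rho (a *: x)) m = a ^+ k *: iter k (rho x) m.
Proof.
elim: k => [|k IHk]; first by rewrite scale1r.
by rewrite !iterS IHk actZl linearZ scalerA -exprS.
Qed.

End ActionTheory.

Section Alternating.
Variables (F : fieldType) (p : nat) (g : restrictedLieType F p).
Variables (M : lmodType F) (rho : restricted_module g M).
Variables (phi : g -> g -> M) (phi_alt : alternating2 phi).

Lemma alternatingC x y : phi x y = - phi y x.
Proof.
have [phiPl phiPr phixx] := phi_alt; have := phixx (x + y).
rewrite (linear_funD (phiPl _)) !(linear_funD (phiPr _)) !phixx add0r addr0.
by move/eqP; rewrite addr_eq0 => /eqP.
Qed.

(** Matches the coboundary with the Jacobi identity: each summand is the kernel component of one
    double bracket. *)
Lemma delta_cl2_cyclic x y z :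
  delta_cl2 rho phi x y z =
  (phi (bracket x y) z - rho z (phi x y))
  + (phi (bracket y z) x - rho x (phi y z))
  + (phi (bracket z x) y - rho y (phi z x)).
Proof.
have [phiPl _ _] := phi_alt; rewrite /delta_cl2 [bracket z x]bracketC.
rewrite (linear_funN (phiPl y)) (alternatingC z x) raddfN opprK !addrA.
by rewrite [RHS](ACl (1*5*3*4*6*2)).
Qed.

End Alternating.

(** * Left-normed brackets of a section *)

Section BracketDefect.
Variables (F : fieldType) (p : nat) (g : restrictedLieType F p).
Variables (M : lmodType F) (rho : restricted_module g M).
Variable phi : g -> g -> M.

(* The sum over k in the *-property, for words of arbitrary length: it measures
   how far a linear section is from preserving left-normed brackets. *)
Definition bracket_defect (s : seq g) : M :=
  \sum_(k < (size s).-1) (-1) ^+ k *: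
    foldl (fun m x => rho x m)
          (phi (lbracket (take (size s - k.+1) s)) s`_(size s - k.+1))
          (drop (size s - k) s).

Lemma star_sumE s : size s = p -> star_sum rho phi s = bracket_defect s.
Proof. by rewrite /bracket_defect => ->. Qed.

(** Identifies the sum in [beta] as the defect of the word x y .. y, of length p + 1. *)
Lemma bracket_defect_nseq x y :
  \sum_(i < p) (-1) ^+ i *:
    iter i (rho y) (phi (lbracket (x :: nseq (p.-1 - i) y)) y)
  = bracket_defect (x :: nseq p y).
Proof.
rewrite /bracket_defect /= size_nseq; apply: eq_bigr => i _; congr (_ *: _).
rewrite subSS -subn1 -subnAC subSn ?(ltnW (ltn_ord i)) //=.
have lti := ltn_ord i; have lep : (p - i.+1 <= p)%N by rewrite leq_subr.
rewrite -(subnSK lti) subn1 /= take_nseq // nth_nseq ltn_subrL.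
rewrite (leq_trans _ lti) //=.
rewrite subnSK // drop_nseq ?leq_subr // subKn ?(ltnW lti) //.
by elim: (i : nat) (phi _ y) => //= k IHk m; rewrite -IHk -iterSr.
Qed.

Lemma bracket_defect1 x : bracket_defect [:: x] = 0.
Proof. exact: big_ord0. Qed.

(** The term k = 0 is the new value of phi; in all others y acts last, and the shift of k gives the
    sign. This is how the kernel component changes when sigma u + iota m is bracketed with sigma
    y. *)
Lemma bracket_defect_rcons x s y :
  bracket_defect (rcons (x :: s) y) =
  phi (lbracket (x :: s)) y - rho y (bracket_defect (x :: s)).
Proof.
rewrite /bracket_defect size_rcons big_ord_recl expr0 scale1r.
set t := x :: s; rewrite subSS !subn0 drop_oversize ?size_rcons //.
rewrite nth_rcons ltnn eqxx -{1}cats1 take_size_cat //.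
rewrite linear_sum -sumrN; congr (_ + _); apply: eq_bigr => i _.
rewrite lift0 exprS mulN1r scaleNr [in RHS]linearZ_LR; congr (- (_ *: _)).
have lti : (size t - i.+1 < size t)%N by rewrite ltn_subrL.
rewrite !subSS -/(size t) nth_rcons lti -{1}cats1 takel_cat ?(ltnW lti) //.
by rewrite drop_rcons ?leq_subr // foldl_rcons.
Qed.

Variables (L : lieType F) (iota : {linear M -> L}) (sigma : g -> L).
Hypothesis iota_act :
  forall x m, bracket (sigma x) (iota m) = iota (rho x m).
Hypothesis sigma_bracket :
  forall x y,
    bracket (sigma x) (sigma y) = sigma (bracket x y) + iota (phi x y).
Hypothesis sigmaD : forall x y, sigma (x + y) = sigma x + sigma y.

Lemma lbracket_section s :
  lbracket (map sigma s) = sigma (lbracket s) + iota (bracket_defect s).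
Proof.
case: s => [|x s].
  rewrite [bracket_defect _]big_ord0 raddf0 addr0 /=.
  by apply: (addrI (sigma 0)); rewrite -sigmaD !addr0.
elim/last_ind: s => [|s y IHs]; first by rewrite bracket_defect1 raddf0 addr0.
rewrite -rcons_cons map_rcons map_cons lbracket_rcons -map_cons IHs.
rewrite !lbracket_rcons bracket_defect_rcons bracketDl sigma_bracket raddfB.
by rewrite [bracket (iota _) _]bracketC iota_act addrA.
Qed.

End BracketDefect.

Lemma sum_gh_word (V : nmodType) (p : nat) (G : seq bool -> V) : (1 < p)%N ->
  \sum_(w : p.-tuple bool | gh_word w) G w =
  \sum_(w : p.-2.-tuple bool) G [:: true, false & w].
Proof.
case: p => [|[|q]] // _; rewrite big_mkcond.
pose H (w : seq bool) :=
  if (nth false w 0 && ~~ nth true w 1)%N then G w else 0.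
rewrite [LHS](sum_tuple_bool_cons _ H).
rewrite (sum_tuple_bool_cons _ (fun w => H (true :: w) + H (false :: w))).
by apply: eq_bigr => w _; rewrite /H /= !addr0 add0r.
Qed.

(** * The cochain of a section *)

Section ExtensionCochains.
Variables (F : fieldType) (p : nat) (charFp : p \in [pchar F]).
Variables (g h : restrictedLieType F p) (h_sab : strongly_abelian h).
Variable rho : restricted_module g h.
Implicit Types (E : extension rho) (c : precochain2 g h).

Lemma ext_iota_bracket E m n :
  bracket (ext_iota E m) (ext_iota E n) = 0.
Proof.
have [_ iotaM _] := ext_iota_hom E.
by rewrite -iotaM (proj1 h_sab) raddf0.
Qed.

Lemma ext_pi_bracket E (x y : E) :
  ext_pi (bracket x y) = bracket (ext_pi x) (ext_pi y).
Proof. by have [] := ext_pi_hom E. Qed.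

Lemma ext_pi_pmap E (x : E) : ext_pi (Defs.pmap x) = Defs.pmap (ext_pi x).
Proof. by have [] := ext_pi_hom E. Qed.

Lemma ext_pi_iota E m : ext_pi (ext_iota E m) = 0.
Proof. by apply/ext_exact; exists m. Qed.

Lemma ext_pi_inj E (x y : E) :
  ext_pi x = ext_pi y -> exists m, x = ext_iota E m + y.
Proof.
move=> eq_pi; have /ext_exact[m Em] : ext_pi (x - y) = 0.
  by rewrite raddfB /= eq_pi subrr.
by exists m; rewrite Em subrK.
Qed.

(* By the vanishing of [h, h], the only word that contributes to the p-power
   of a sum with an element m of h is (e, m, e, .., e). *)
Lemma pmap_add_iota E (e : E) (m : h) :
  Defs.pmap (e + ext_iota E m) =
  Defs.pmap e + ext_iota E (iter p.-1 (rho (ext_pi e)) m).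
Proof.
have p_pr := pcharf_prime charFp; have p0 := pcharf0 charFp.
have [_ _ iotaP] := ext_iota_hom E.
rewrite pmapD -iotaP (proj2 h_sab) raddf0 addr0; congr (_ + _).
have word w n : foldl bracket (ext_iota E n) (spell e (ext_iota E m) w) =
    if all id w
    then (-1) ^+ size w *: ext_iota E (iter (size w) (rho (ext_pi e)) n)
    else 0.
  elim: w n => [|[] w IHw] n /=; first by rewrite scale1r.
    rewrite bracketC ext_act -raddfN IHw; case: ifP => // _.
    by rewrite iter_actN -iterSr exprS mulN1r scaleNr [in LHS]raddfN scalerN.
  by rewrite ext_iota_bracket foldl_bracket0.
rewrite (sum_gh_word (fun w => (count id w)%:R^-1 *:
  lbracket (spell e (ext_iota E m) w))) ?prime_gt1 //.
transitivity (\sum_(w : p.-2.-tuple bool | w == nseq_tuple p.-2 true)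
    ext_iota E (iter p.-1 (rho (ext_pi e)) m)); last by rewrite big_pred1_eq.
rewrite [RHS]big_mkcond; apply: eq_bigr => w _ /=.
rewrite ext_act word add0n add1n size_tuple.
have -> : (w == nseq_tuple p.-2 true) = all id w.
  rewrite -val_eqE /= -[in nseq _ _](size_tuple w).
  by rewrite (sameP eqP (all_pred1P true w)); apply: eq_all => -[].
case: ifP => [all_w|_]; last by rewrite scaler0.
have p1E : p.-2.+1 = p.-1 by case: (p) p_pr => [|[]].
move: (all_w); rewrite all_count size_tuple => /eqP ->; rewrite p1E.
rewrite -iterSr p1E scalerA.
(* The word has p - 1 letters e, and the p - 2 of them after m each give a sign. In F, p - 1 = -1
   and (-1)^(p-1) = C(p-1, p-1) = 1, also for p = 2. *)
have -> : p.-1%:R^-1 * (-1) ^+ p.-2 = 1 :> F; last by rewrite scale1r.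
have -> : p.-1%:R = -1 :> F by rewrite -subn1 natrB ?prime_gt0 // p0 sub0r.
rewrite invrN1 -exprS p1E.
by rewrite -(bin_pred_prime p_pr p0) ?binn // prednK ?prime_gt0.
Qed.

Lemma cochain_eq E (sigma : g -> E) c c' :
  ext_cochain sigma c -> ext_cochain sigma c' -> c = c'.
Proof.
case: c c' => [phi omega] [phi' omega'] [/= Hphi Homega] [/= Hphi' Homega'].
congr pair; apply/funext => x; last first.
  by apply: (@ext_iota_inj _ _ _ _ _ E); rewrite Homega Homega'.
by apply/funext => y; apply: (@ext_iota_inj _ _ _ _ _ E); rewrite Hphi Hphi'.
Qed.

Lemma cochain_exists E (sigma : g -> E) :
  ext_section sigma -> exists c, ext_cochain sigma c.
Proof.
move=> [lin_sigma sigmaK].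
have [phi Hphi] : {phi : g * g -> h & forall xy, ext_iota E (phi xy) =
    bracket (sigma xy.1) (sigma xy.2) - sigma (bracket xy.1 xy.2)}.
  apply: (choice (P := fun (xy : g * g) m => ext_iota E m =
    bracket (sigma xy.1) (sigma xy.2) - sigma (bracket xy.1 xy.2))) => xy.
  by apply/ext_exact; rewrite raddfB /= ext_pi_bracket !sigmaK subrr.
have [omega Homega] : {omega : g -> h & forall x, ext_iota E (omega x) =
    Defs.pmap (sigma x) - sigma (Defs.pmap x)}.
  apply: (choice (P := fun x m => ext_iota E m =
    Defs.pmap (sigma x) - sigma (Defs.pmap x))) => x.
  by apply/ext_exact; rewrite raddfB /= ext_pi_pmap !sigmaK subrr.
by exists (fun x y => phi (x, y), omega); split => // x y; rewrite Hphi.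
Qed.

Section SectionCochain.
Variables (E : extension rho) (sigma : g -> E) (c : precochain2 g h).
Hypotheses (sigma_section : ext_section sigma) (sigma_c : ext_cochain sigma c).

Let lin_sigma : linear sigma := proj1 sigma_section.
Let sigmaK : cancel sigma (@ext_pi _ _ _ _ _ E) := proj2 sigma_section.
HB.instance Definition _ := GRing.isLinear.Build F g E *:%R sigma lin_sigma.

Lemma section_bracket x y :
  bracket (sigma x) (sigma y) = sigma (bracket x y) + ext_iota E (c.1 x y).
Proof. by rewrite (proj1 sigma_c) addrC subrK. Qed.

Lemma section_pmap x :
  Defs.pmap (sigma x) = sigma (Defs.pmap x) + ext_iota E (c.2 x).
Proof. by rewrite (proj2 sigma_c) addrC subrK. Qed.

Lemma section_act x m : bracket (sigma x) (ext_iota E m) = ext_iota E (rho x m).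
Proof. by rewrite ext_act sigmaK. Qed.

Lemma section_lbracket s :
  lbracket (map sigma s) =
  sigma (lbracket s) + ext_iota E (bracket_defect rho c.1 s).
Proof.
exact: (lbracket_section section_act section_bracket (raddfD sigma)).
Qed.

Lemma section_bracket2 x y z :
  bracket (bracket (sigma x) (sigma y)) (sigma z) =
  sigma (bracket (bracket x y) z) +
  ext_iota E (c.1 (bracket x y) z - rho z (c.1 x y)).
Proof.
rewrite section_bracket bracketDl section_bracket raddfB /= addrA.
by rewrite [bracket (ext_iota E _) _]bracketC section_act.
Qed.

Lemma ext_cochain_alternating : alternating2 c.1.
Proof.
have [Hphi _] := sigma_c; have iota_inj := @ext_iota_inj _ _ _ _ _ E.
split=> [z a x y|x a y z|x]; apply: iota_inj.
- rewrite [RHS]linearP /= !Hphi linearP /= !bracketPl linearP /=.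
  by rewrite scalerBr opprD addrACA.
- rewrite [RHS]linearP /= !Hphi !linearP /=.
  by rewrite scalerBr scalerN addrACA.
- by rewrite Hphi !bracketxx !raddf0 addr0.
Qed.

(** Subtract the image under sigma of the sum formula in g from the sum formula in E: word by word,
    what remains is the bracket defect. *)
Lemma ext_cochain_star : star_property rho c.1 c.2.
Proof.
have [_ Homega] := sigma_c; have iota_inj := @ext_iota_inj _ _ _ _ _ E.
split=> [a x|x y]; apply: iota_inj.
  by rewrite [RHS]linearZ /= !Homega linearZ /= !pmapZ linearZ scalerBr.
rewrite Homega raddfD /= !pmapD !raddfD /= !Homega.
rewrite addrACA [X in X + _ = _]addrACA; congr (_ + _).
rewrite !linear_sum -big_split; apply: eq_bigr => w _ /=.
rewrite !linearZ -scalerDr /= star_sumE ?size_map ?size_tuple //.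
by rewrite spell_map section_lbracket addrAC subrr add0r.
Qed.

Lemma ext_cochain_Z2 : Z2 rho c.
Proof.
have iota_inj := @ext_iota_inj _ _ _ _ _ E.
split.
  by split; [exact: ext_cochain_alternating | exact: ext_cochain_star].
congr pair; apply/funext => x; apply/funext => y; last first.
  apply: iota_inj; rewrite /beta bracket_defect_nseq.
  (* The p-map axiom of E turns this bracket into [sigma x, sigma(y)^[p]]; comparing the two
     expansions yields beta = 0. *)
  have := section_lbracket (x :: nseq p y).
  rewrite map_cons map_nseq -!bracket_pmap section_pmap raddfD /= section_act.
  rewrite section_bracket -addrA => /addrI.
  by rewrite addrAC raddfB raddfD /= => ->; rewrite subrr raddf0.
apply/funext => z; apply: iota_inj => /=.
have := bracket_jacobi (sigma x) (sigma y) (sigma z).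
have collect u u' m m' : sigma u + ext_iota E m + (sigma u' + ext_iota E m') =
    sigma (u + u') + ext_iota E (m + m') by rewrite addrACA !raddfD.
rewrite !section_bracket2 !collect bracket_jacobi.
rewrite -delta_cl2_cyclic; last exact: ext_cochain_alternating.
by rewrite !raddf0 add0r => ->.
Qed.

Lemma section_decomposition e : exists m, e = ext_iota E m + sigma (ext_pi e).
Proof. by apply: ext_pi_inj; rewrite sigmaK. Qed.

(** In these coordinates the structure of E depends only on rho and c, so extensions with a common
    cochain are isomorphic. The formulas are those defining the twisted algebra. *)
Lemma decomposed_bracket m x n y :
  bracket (ext_iota E m + sigma x) (ext_iota E n + sigma y) =
  ext_iota E (rho x n - rho y m + c.1 x y) + sigma (bracket x y).
Proof.
rewrite bracketDl !raddfD /= ext_iota_bracket add0r section_act section_bracket.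
rewrite [bracket (ext_iota E _) _]bracketC section_act.
rewrite [ext_iota E (- _)]raddfN.
by rewrite !addrA [LHS](ACl (2*1*4*3)).
Qed.

Lemma decomposed_pmap m x :
  Defs.pmap (ext_iota E m + sigma x) =
  ext_iota E (iter p.-1 (rho x) m + c.2 x) + sigma (Defs.pmap x).
Proof.
rewrite addrC pmap_add_iota sigmaK section_pmap raddfD /= -addrA addrC.
by rewrite [X in X + _ = _]addrC.
Qed.

(** The term x^(p-1) psi(x) of [delta1] comes from [pmap_add_iota], applied to sigma x and - psi
    x. *)
Lemma ext_cochain_change (psi : g -> h) :
  linear psi ->
  ext_section (fun x => sigma x - ext_iota E (psi x)) /\
  ext_cochain (fun x => sigma x - ext_iota E (psi x)) (c + delta1 rho psi).
Proof.
move=> lin_psi; split.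
  split=> [a x y|x]; last by rewrite raddfB /= ext_pi_iota subr0 sigmaK.
  by rewrite lin_psi !linearP /= scalerBr addrACA scalerN.
split=> [x y|x].
  rewrite bracketBl !raddfB /= ext_iota_bracket !opprK addr0 !section_act.
  rewrite [bracket (ext_iota E _) _]bracketC section_act section_bracket.
  rewrite -[(_ + _) x y]/(c.1 x y + delta_cl1 rho psi x y).
  rewrite !raddfD /= !raddfN /= opprK !addrA.
  by rewrite [RHS](ACl (1*5*2*3*4*6)) /= subrr add0r.
rewrite -raddfN pmap_add_iota sigmaK section_pmap iter_actN.
rewrite -[_.2 x]/(c.2 x + (psi (Defs.pmap x) - iter p.-1 (rho x) (psi x))).
rewrite !raddfD /= !raddfN /= opprK !addrA.
by rewrite [RHS](ACl (1*4*2*5*3)) /= subrr add0r.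
Qed.

End SectionCochain.

End ExtensionCochains.

(** * The extension defined by a cocycle *)

Section SemidirectEndo.
Variables (F : fieldType) (p : nat) (charFp : p \in [pchar F]).
Variables (g : restrictedLieType F p) (M : lmodType F).
Variable rho : restricted_module g M.
Implicit Types X Y : M * g.

Definition semidirect_bracket X Y : M * g :=
  (rho X.2 Y.1 - rho Y.2 X.1, bracket X.2 Y.2).

Lemma foldl_semidirect_bracket_snd X s :
  (foldl semidirect_bracket X s).2 = lbracket (map snd (X :: s)).
Proof. by elim: s X => //= Y s IHs X; rewrite IHs. Qed.

Fact semidirect_endo_subproof X :
  {morph (fun u : M * F^o => (rho X.2 u.1 + u.2 *: X.1, 0 : F^o))
     : u v / u - v}.
Proof.
move=> u v; congr pair; last by rewrite subr0.
by rewrite /= raddfB scalerBl opprD addrACA.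
Qed.

(* The affine matrix [[rho x, m], [0, 0]] of X = (m, x), which embeds the
   semidirect product into an associative algebra. *)
Definition semidirect_endo X : endo (M * F^o)%type :=
  Endo (semidirect_endo_subproof X).

(** Reads off the translation part. On the p-th power of the matrix of (m, x) it gives x^(p-1) m,
    the module component of the p-map of the semidirect product. *)
Definition affine_part (a : endo (M * F^o)%type) : M := (a (0, 1)).1.
Fact affine_part_is_zmod_morphism : zmod_morphism affine_part.
Proof. by []. Qed.
HB.instance Definition _ := GRing.isZmodMorphism.Build _ _ affine_part
  affine_part_is_zmod_morphism.

Lemma affine_part_semidirect X : affine_part (semidirect_endo X) = X.1.
Proof. by rewrite /affine_part /= raddf0 add0r scale1r. Qed.

Lemma semidirect_endoD X Y :
  semidirect_endo (X + Y) = semidirect_endo X + semidirect_endo Y.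
Proof.
apply: endoP => u; congr pair; last by rewrite /= addr0.
by rewrite /= actDl scalerDr addrACA.
Qed.

Lemma semidirect_endo_commutator X Y :
  commutator (semidirect_endo X) (semidirect_endo Y) =
  semidirect_endo (semidirect_bracket X Y).
Proof.
apply: endoP => u; congr pair; last by rewrite /= subr0.
rewrite /= !scale0r !addr0 act_bracket ![in LHS]linearD ![in LHS]linearZ /=.
by rewrite scalerBr addrACA scalerN.
Qed.

Lemma foldl_semidirect_commutator X s :
  foldl commutator (semidirect_endo X) (map semidirect_endo s) =
  semidirect_endo (foldl semidirect_bracket X s).
Proof. by elim: s X => //= Y s IHs X; rewrite semidirect_endo_commutator. Qed.

Lemma semidirect_endo_exp X k u :
  (semidirect_endo X ^+ k.+1) u =
  (iter k (rho X.2) (rho X.2 u.1 + u.2 *: X.1), 0).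
Proof.
rewrite endo_exprE; elim: k => [|k IHk] //.
by rewrite iterS IHk /= scale0r addr0.
Qed.

Lemma endo_char : p%:R = 0 :> endo (M * F^o)%type.
Proof.
apply: endoP => u; rewrite -[LHS]/(endo_eval u _) raddfMn /= /endo_eval /=.
by rewrite -(scaler_nat p (u : M * F^o)) (pcharf0 charFp) scale0r.
Qed.

Let p_pr := pcharf_prime charFp.

Lemma affine_part_exp X :
  affine_part (semidirect_endo X ^+ p) = iter p.-1 (rho X.2) X.1.
Proof.
rewrite -[X in _ ^+ X](prednK (prime_gt0 p_pr)) /affine_part.
by rewrite semidirect_endo_exp /= raddf0 add0r scale1r.
Qed.

Lemma semidirect_pmapD X Y :
  iter p.-1 (rho (X.2 + Y.2)) (X.1 + Y.1) =
  iter p.-1 (rho X.2) X.1 + iter p.-1 (rho Y.2) Y.1 +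
  \sum_(w : p.-tuple bool | gh_word w) (count id w)%:R^-1 *:
     (foldl semidirect_bracket X (behead (spell X Y w))).1.
Proof.
have := jacobson_formula charFp affine_part (semidirect_endo X)
  (semidirect_endo Y) endo_char.
rewrite /= -semidirect_endoD !affine_part_exp => ->; congr (_ + _).
apply: eq_bigr => w _; congr (_ *: _).
rewrite spell_map behead_map foldl_semidirect_commutator.
by rewrite affine_part_semidirect.
Qed.

(** In the matrix ring, bracketing p times with b is bracketing with b^p. The module being
    restricted identifies the linear part of b^p with the action of the p-map. *)
Lemma semidirect_bracket_pmap X Y :
  (foldl semidirect_bracket X (nseq p Y)).1 =
  rho X.2 (iter p.-1 (rho Y.2) Y.1) - rho (Defs.pmap Y.2) X.1.
Proof.
rewrite -affine_part_semidirect -foldl_semidirect_commutator map_nseq.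
rewrite commutator_expr_prime ?endo_char // raddfB /= act_pmap.
rewrite -[X in _ ^+ X](prednK (prime_gt0 p_pr)) /affine_part.
rewrite !endo_mulE !semidirect_endo_exp /= !raddf0 !scale0r !scale1r.
by rewrite !add0r !addr0 -iterSr prednK ?prime_gt0.
Qed.

End SemidirectEndo.

Section Twisted.
Variables (F : fieldType) (p : nat) (charFp : p \in [pchar F]).
Variables (g h : restrictedLieType F p).
Variables (rho : restricted_module g h) (c : precochain2 g h) (Hc : Z2 rho c).

(* The kernel is a restricted Lie algebra, not an arbitrary module, only because
   the universe of lmodType lies strictly above that of restrictedLieType. *)
Definition twisted of p \in [pchar F] & Z2 rho c := (h * g)%type.
Local Notation T := (twisted charFp Hc).
HB.instance Definition _ := GRing.Lmodule.copy T (h * g)%type.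
Implicit Types X Y Z : T.

Definition twisted_bracket X Y : T :=
  (rho X.2 Y.1 - rho Y.2 X.1 + c.1 X.2 Y.2, bracket X.2 Y.2).

Definition twisted_pmap X : T :=
  (iter p.-1 (rho X.2) X.1 + c.2 X.2, Defs.pmap X.2).

Let c_alt : alternating2 c.1 := proj1 (proj1 Hc).
Let delta_c0 : delta2 rho c = 0 := proj2 Hc.

Let phiPl y : linear (c.1^~ y). Proof. by case: c_alt. Qed.
Let phiPr x : linear (c.1 x). Proof. by case: c_alt. Qed.
Let phixx x : c.1 x x = 0. Proof. by case: c_alt. Qed.

Fact twisted_bracket_linearl Z : linear (twisted_bracket^~ Z).
Proof.
move=> a X Y; congr pair; rewrite /= ?bracketPl //.
rewrite actPl linearP /= (phiPl _ a) opprD.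
by rewrite [X in X + _ = _]addrACA [LHS]addrACA -scalerN -!scalerDr.
Qed.

Fact twisted_bracket_linearr Z : linear (twisted_bracket Z).
Proof.
move=> a X Y; congr pair; rewrite /= ?linearP //.
rewrite actPl (phiPr _ a) /= opprD.
by rewrite [X in X + _ = _]addrACA [LHS]addrACA -scalerN -!scalerDr.
Qed.

Fact twisted_bracketxx X : twisted_bracket X X = 0.
Proof. by congr pair; rewrite /= ?bracketxx // subrr phixx addr0. Qed.

Fact twisted_bracket_jacobi X Y Z :
  twisted_bracket (twisted_bracket X Y) Z
  + twisted_bracket (twisted_bracket Y Z) X
  + twisted_bracket (twisted_bracket Z X) Y = 0.
Proof.
case: X Y Z => [m x] [n y] [l z].
congr pair; rewrite /= ?bracket_jacobi //.
(* Separates the terms in c, which form the coboundary, from the Jacobi identity of the semidirect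
   product. *)
have split_coboundary k u v v' w t :
    u - rho k (v - v' + w) + t = (u - rho k (v - v')) + (t - rho k w).
  by rewrite linearD opprD !addrA [RHS]addrAC.
rewrite !split_coboundary.
rewrite [X in X + _ = 0]addrACA [LHS]addrACA -(delta_cl2_cyclic rho c_alt).
have -> : delta_cl2 rho c.1 x y z = 0.
  by rewrite -[LHS]/((delta2 rho c).1 x y z) delta_c0.
rewrite addr0.
rewrite !act_bracket ![rho _ (_ - _)]linearB /= !opprB !addrA.
(* The twelve double actions cancel in pairs. *)
rewrite [LHS](ACl ((1*8)*(11*2)*(3*6)*(9*4)*(5*12)*(7*10))) /=.
by rewrite !subrr !addr0.
Qed.

HB.instance Definition _ := Lmodule_isLie.Build F T
  twisted_bracket_linearl twisted_bracket_linearr twisted_bracketxx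
  twisted_bracket_jacobi.

(** Bracketing with Y on the right is affine in the kernel component, so the contribution of c
    splits off and follows the recursion of [bracket_defect]. This reduces the p-map axioms to the
    semidirect case plus the cocycle conditions. *)
Lemma twisted_lbracket X s :
  lbracket (X :: s) =
  foldl (semidirect_bracket rho) X s
  + (bracket_defect rho c.1 (map snd (X :: s)), 0).
Proof.
elim/last_ind: s => [|s Y IHs].
  by rewrite bracket_defect1; apply/esym/addr0.
rewrite -rcons_cons lbracket_rcons IHs foldl_rcons map_rcons.
rewrite bracket_defect_rcons -map_cons -(foldl_semidirect_bracket_snd rho).
congr pair; rewrite /= !addr0 //.
by rewrite linearD opprD /= !addrA [LHS]addrAC.
Qed.

Lemma twisted_lbracket_snd (s : seq T) : (lbracket s).2 = lbracket (map snd s).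
Proof.
case: s => // X s; rewrite twisted_lbracket /= addr0.
exact: foldl_semidirect_bracket_snd.
Qed.

Fact twisted_pmapZ a X : twisted_pmap (a *: X) = a ^+ p *: twisted_pmap X.
Proof.
have [[_ [omegaZ _]] _] := Hc.
congr pair; rewrite /= ?pmapZ // omegaZ iter_actZl.
have iterZ k b m : iter k (rho X.2) (b *: m) = b *: iter k (rho X.2) m.
  by elim: k => //= k ->; rewrite linearZ.
rewrite iterZ scalerA -exprSr prednK ?prime_gt0 ?(pcharf_prime charFp) //.
by rewrite -scalerDr.
Qed.

Lemma map_snd_spell X Y w : map snd (spell X Y w) = spell X.2 Y.2 w.
Proof. by rewrite -spell_map. Qed.

Fact twisted_pmapD X Y :
  twisted_pmap (X + Y) = twisted_pmap X + twisted_pmap Y +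
    \sum_(w : p.-tuple bool | gh_word w)
       (count id w)%:R^-1 *: lbracket (spell X Y w).
Proof.
have [[_ [_ omegaD]] _] := Hc.
have lbracketE (w : p.-tuple bool) : gh_word w -> lbracket (spell X Y w) =
    foldl (semidirect_bracket rho) X (behead (spell X Y w)) +
      (star_sum rho c.1 (spell X.2 Y.2 w), 0).
  rewrite star_sumE ?size_map ?size_tuple // /gh_word -map_snd_spell.
  by case: (tval w) => [|[] v] // _; exact: twisted_lbracket.
congr pair; rewrite /=.
  rewrite semidirect_pmapD // omegaD [LHS]addrACA [X in X + _ = _]addrACA.
  congr (_ + _).
  rewrite -big_split [RHS](raddf_sum (@fst h g)); apply: eq_bigr => w ghw.
  by rewrite /= lbracketE // -scalerDr.
rewrite pmapD; congr (_ + _).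
rewrite [RHS](raddf_sum (@snd h g)).
by apply: eq_bigr => w _; rewrite /= twisted_lbracket_snd map_snd_spell.
Qed.

Fact twisted_bracket_pmap X Y :
  bracket X (twisted_pmap Y) = lbracket (X :: nseq p Y).
Proof.
rewrite twisted_lbracket.
congr pair; rewrite /=; last first.
  by rewrite addr0 foldl_semidirect_bracket_snd map_cons map_nseq bracket_pmap.
rewrite semidirect_bracket_pmap // map_nseq -bracket_defect_nseq.
have : beta rho c.1 c.2 X.2 Y.2 = 0.
  by rewrite -[LHS]/((delta2 rho c).2 X.2 Y.2) delta_c0.
rewrite /beta => /eqP; rewrite addrAC subr_eq0 => /eqP <-.
by rewrite linearD /= !addrA [LHS]addrAC [RHS](ACl (1*4*2*3)) /= addrAC.
Qed.

HB.instance Definition _ := Lie_isRestricted.Build F p T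
  twisted_pmapZ twisted_pmapD twisted_bracket_pmap.

End Twisted.

(** * The correspondence *)

Section LinearSplitting.
Local Open Scope classical_set_scope.
Variables (F : fieldType) (U V : lmodType F) (f : {linear U -> V}).

(* 0 is not required to be in W, so that the empty chain has an upper bound. *)
Let partial_complement (W : set U) : Prop :=
  (forall (a : F) u v, W u -> W v -> W (a *: u + v)) /\
  (forall u, W u -> f u = 0 -> u = 0).

Let maximal_complement :
  exists W, partial_complement W /\
    forall W', W `<` W' -> ~ partial_complement W'.
Proof.
apply: Zorn_bigcup => C CP Ctot.
split=> [a u v [W CW Wu] [W' CW' W'v]|u [W /CP[_ W0]]].
  have [/(_ _ Wu) W'u|/(_ _ W'v) Wv] := Ctot W W' CW CW'.
    by exists W' => //; have [lin _] := CP _ CW'; exact: lin.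
  by exists W => //; have [lin _] := CP _ CW; exact: lin.
exact: W0.
Qed.

(** A maximal subspace W meeting the kernel trivially maps onto V, and s inverts f on W. *)
Lemma linear_splitting :
  (forall y, exists x, f x = y) -> exists s : V -> U, linear s /\ cancel s f.
Proof.
move=> f_surj; have [W [[Wlin Wker] Wmax]] := maximal_complement.
have W0 : W 0.
  apply: contrapT => nW0; apply: (Wmax (W `|` [set 0])).
    by split=> [u Wu|/(_ 0 (or_intror erefl))//]; left.
  have WZ a u : W u -> W (a *: u).
    by move=> Wu; rewrite -[a](subrK 1) scalerDl scale1r; exact: Wlin.
  split=> [a u v [Wu|->] [Wv|->]|u [/Wker//|->//]].
  - by left; exact: Wlin.
  - by left; rewrite addr0; exact: WZ.
  - by left; rewrite scaler0 add0r.
  - by right; rewrite scaler0 add0r.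
have fW y : exists w, W w /\ f w = y.
  apply: contrapT => noW; have [x fx] := f_surj y.
  have nWx : ~ W x by move=> Wx; apply: noW; exists x.
  (* If y is not in f(W), then W + F x still meets the kernel trivially: f(a x + w) = 0 with a
     nonzero would give y = f(- a^-1 w). *)
  apply: (Wmax [set u | exists a w, W w /\ u = a *: x + w]).
    split=> [w Ww|sub]; first by exists 0, w; rewrite scale0r add0r.
    by apply/nWx/sub; exists 1, 0; rewrite scale1r addr0.
  split=> [b _ _ [a [w [Ww ->]]] [a' [w' [Ww' ->]]]|_ [a [w [Ww ->]]]].
    exists (b * a + a'), (b *: w + w'); split; first exact: Wlin.
    by rewrite scalerDl scalerDr scalerA addrACA.
  have [->|a_neq0] := eqVneq a 0; first by rewrite scale0r add0r; exact: Wker.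
  rewrite linearP fx => /eqP; rewrite addr_eq0 => /eqP ayw; case: noW.
  exists (- a^-1 *: w + 0); split; first exact: Wlin.
  by rewrite addr0 linearZ /= scaleNr -scalerN -ayw scalerA mulVf ?scale1r.
have [s sP] := choice fW.
exists s; split=> [a y z|y]; last by case: (sP y).
have [Wayz fayz] := sP (a *: y + z); have [[Wy fy] [Wz fz]] := (sP y, sP z).
have /Wker : W (-1 *: s (a *: y + z) + (a *: s y + s z)) by do 2?apply: (Wlin).
have -> : f (-1 *: s (a *: y + z) + (a *: s y + s z)) = 0.
  by rewrite linearD linearZ linearP /= fayz fy fz scaleN1r addNr.
move=> /(_ erefl)/eqP.
by rewrite scaleN1r addr_eq0 eqr_opp => /eqP.
Qed.

End LinearSplitting.

Section TwistedExtension.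
Variables (F : fieldType) (p : nat) (charFp : p \in [pchar F]).
Variables (g h : restrictedLieType F p) (h_sab : strongly_abelian h).
Variables (rho : restricted_module g h) (c : precochain2 g h) (Hc : Z2 rho c).
Local Notation T := (twisted charFp Hc).

Let phiPl y : linear (c.1^~ y). Proof. by case: Hc => [[[]]]. Qed.
Let phiPr x : linear (c.1 x). Proof. by case: Hc => [[[]]]. Qed.

Lemma pmap0 (L : restrictedLieType F p) : Defs.pmap (0 : L) = 0.
Proof.
rewrite -[in LHS](scale0r (0 : L)) pmapZ expr0n gtn_eqF ?scale0r //.
exact: prime_gt0 (pcharf_prime charFp).
Qed.

Lemma iter_act0l k m : (0 < k)%N -> iter k (rho 0) m = 0.
Proof. by case: k => // k _; rewrite iterS act0l. Qed.

Definition twisted_iota (m : h) : T := (m, 0).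
Definition twisted_pi (X : T) : g := X.2.

Fact twisted_iota_hom : restricted_hom twisted_iota.
Proof.
have p_gt1 := prime_gt1 (pcharf_prime charFp).
have omega0 : c.2 0 = 0.
  have [[_ [omegaZ _]] _] := Hc.
  by rewrite -[in LHS](scale0r (0 : g)) omegaZ expr0n gtn_eqF ?scale0r // ltnW.
split=> [a m n|m n|m]; congr pair; rewrite /= ?bracketxx ?pmap0 //.
- by rewrite scaler0 addr0.
- by rewrite (proj1 h_sab) !act0l subrr add0r (linear_fun0 (phiPr 0)).
(* Since p > 1, the zero action is applied at least once. *)
- by rewrite (proj2 h_sab) omega0 addr0 iter_act0l // -subn1 subn_gt0.
Qed.

Fact twisted_pi_hom : restricted_hom twisted_pi.
Proof. by split. Qed.

Fact twisted_iota_inj : injective twisted_iota.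
Proof. by move=> m n []. Qed.

Fact twisted_exact X : twisted_pi X = 0 <-> exists m, twisted_iota m = X.
Proof.
by case: X => m x; split=> [/= -> |[_ [_ <-]] //]; exists m.
Qed.

Fact twisted_pi_surj x : exists X, twisted_pi X = x.
Proof. by exists (0, x). Qed.

Fact twisted_act X m :
  bracket X (twisted_iota m) = twisted_iota (rho (twisted_pi X) m).
Proof.
congr pair; rewrite /= ?raddf0 // act0l subr0.
by rewrite (linear_fun0 (phiPr _)) addr0.
Qed.

Definition twisted_extension : extension rho :=
  Extension twisted_iota_hom twisted_pi_hom twisted_iota_inj twisted_exact
    twisted_pi_surj twisted_act.

Definition twisted_section (x : g) : twisted_extension := (0, x).

Lemma twisted_sectionP :
  ext_section twisted_section /\ ext_cochain twisted_section c.
Proof.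
split; first by split=> // a x y; congr pair; rewrite /= scaler0 addr0.
split=> [x y|x]; congr pair; rewrite /= ?subrr //.
  by rewrite !raddf0 !add0r addr0.
by rewrite iter_act0 add0r subr0.
Qed.

End TwistedExtension.

(** * Equivalence of extensions in terms of cochains *)

Section Equivalence.
Variables (F : fieldType) (p : nat) (charFp : p \in [pchar F]).
Variables (g h : restrictedLieType F p) (h_sab : strongly_abelian h).
Variable rho : restricted_module g h.
Implicit Types E : extension rho.

Lemma ext_equiv_refl E : ext_equiv E E.
Proof. by exists id; split=> //; exists id. Qed.

Lemma ext_equiv_sym E E' : ext_equiv E E' -> ext_equiv E' E.
Proof.
move=> [alpha [[lin alphaM alphaP] [beta alphaK betaK] iotaE piE]].
exists beta; split; [split=> [a x y|x y|x]| by exists alpha | |].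
- by apply: (can_inj alphaK); rewrite lin !betaK.
- by apply: (can_inj alphaK); rewrite alphaM !betaK.
- by apply: (can_inj alphaK); rewrite alphaP !betaK.
- by move=> m; rewrite -iotaE alphaK.
- by move=> e; rewrite -[in RHS](betaK e) piE.
Qed.

Lemma ext_equiv_trans E1 E2 E3 :
  ext_equiv E1 E2 -> ext_equiv E2 E3 -> ext_equiv E1 E3.
Proof.
move=> [alpha [[lin alphaM alphaP] bij iotaE piE]].
move=> [alpha' [[lin' alphaM' alphaP'] bij' iotaE' piE']].
exists (alpha' \o alpha).
split; [split=> [a x y|x y|x] /=| exact: bij_comp | |].
- by rewrite lin lin'.
- by rewrite alphaM alphaM'.
- by rewrite alphaP alphaP'.
- by move=> m; rewrite /= iotaE iotaE'.
- by move=> e; rewrite /= piE' piE.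
Qed.

Lemma ext_class_eq E E' : ext_equiv E E' -> ext_class E = ext_class E'.
Proof.
move=> EE'; apply/seteqP; split=> E'' /=.
  exact/ext_equiv_trans/ext_equiv_sym.
exact: ext_equiv_trans.
Qed.

Lemma ext_equiv_section E E' (sigma : g -> E) c :
  ext_equiv E E' -> ext_section sigma -> ext_cochain sigma c ->
  exists2 sigma' : g -> E', ext_section sigma' & ext_cochain sigma' c.
Proof.
move=> [alpha [[lin alphaM alphaP] _ iotaE piE]].
move=> [lin_sigma sigmaK] [Hphi Homega].
exists (alpha \o sigma); split.
- by move=> a x y; rewrite /= lin_sigma lin.
- by move=> x; rewrite /= piE.
- by move=> x y; rewrite -iotaE Hphi (linear_funB lin) alphaM.
- by move=> x; rewrite -iotaE Homega (linear_funB lin) alphaP.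
Qed.

Lemma ext_section_exists E : exists sigma : g -> E, ext_section sigma.
Proof. exact: (linear_splitting (@ext_pi_surj _ _ _ _ _ E)). Qed.

Lemma ext_cochain_map E E' (sigma : g -> E) (sigma' : g -> E') :
  ext_section sigma -> exists alpha : E -> E', forall m x,
    alpha (ext_iota E m + sigma x) = ext_iota E' m + sigma' x.
Proof.
move=> sigma_sec.
have [alpha alphaP] := choice (section_decomposition sigma_sec).
exists (fun e => ext_iota E' (alpha e) + sigma' (ext_pi e)) => m x.
have pi_mx : ext_pi (ext_iota E m + sigma x) = x.
  by rewrite raddfD /= ext_pi_iota add0r (proj2 sigma_sec).
rewrite pi_mx; congr (ext_iota E' _ + _); apply: (@ext_iota_inj _ _ _ _ _ E).
apply: (addIr (sigma x)); have := alphaP (ext_iota E m + sigma x).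
by rewrite pi_mx => <-.
Qed.

(** The map matching the coordinates given by the two sections is an isomorphism; its inverse is the
    same construction with the roles exchanged. *)
Lemma ext_cochain_equiv E E' (sigma : g -> E) (sigma' : g -> E') c :
  ext_section sigma -> ext_section sigma' ->
  ext_cochain sigma c -> ext_cochain sigma' c -> ext_equiv E E'.
Proof.
move=> sec sec' coc coc'.
have [alpha alphaE] := ext_cochain_map sigma' sec.
have [beta betaE] := ext_cochain_map sigma sec'.
exists alpha; split; [split| exists beta| |].
- move=> a e f; have [m ->] := section_decomposition sec e.
  have [n ->] := section_decomposition sec f.
  rewrite scalerDr addrACA -linearP /= -(proj1 sec) !alphaE.
  by rewrite linearP (proj1 sec') /= addrACA -scalerDr.
- move=> e f; have [m ->] := section_decomposition sec e.
  have [n ->] := section_decomposition sec f.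
  rewrite (decomposed_bracket h_sab sec coc) !alphaE.
  by rewrite (decomposed_bracket h_sab sec' coc').
- move=> e; have [m ->] := section_decomposition sec e.
  rewrite (decomposed_pmap charFp h_sab sec coc) !alphaE.
  by rewrite (decomposed_pmap charFp h_sab sec' coc').
- move=> e; have [m ->] := section_decomposition sec e.
  by rewrite alphaE betaE.
- move=> e; have [m ->] := section_decomposition sec' e.
  by rewrite betaE alphaE.
- move=> m; have := alphaE m 0.
  by rewrite (linear_fun0 (proj1 sec)) (linear_fun0 (proj1 sec')) !addr0.
- move=> e; have [m ->] := section_decomposition sec e.
  by rewrite alphaE !raddfD /= !ext_pi_iota (proj2 sec) (proj2 sec').
Qed.

End Equivalence.

Theorem theorem3p26 (F : fieldType) (p : nat) (charFp : p \in [pchar F])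
    (g h : restrictedLieType F p) (h_sab : strongly_abelian h)
    (rho : restricted_module g h) :
  exists Phi : set (extension rho) -> set (precochain2 g h),
    set_bij (ext_classes rho) (H2 rho) Phi /\
    forall (E : extension rho) (sigma : g -> E), ext_section sigma ->
      exists2 c : precochain2 g h,
        ext_cochain sigma c & Phi (ext_class E) = cohomology_class rho c.
Proof.
pose Phi (C : set (extension rho)) : set (precochain2 g h) := fun c =>
  exists (E : extension rho) (sigma : g -> E),
    [/\ C E, ext_section sigma & ext_cochain sigma c].
have PhiE (E : extension rho) (sigma : g -> E) c :
    ext_section sigma -> ext_cochain sigma c ->
    Phi (ext_class E) = cohomology_class rho c.
  move=> sec coc; apply/seteqP.
  split=> [c' [E' [sigma' [EE' sec' coc']]]|_ [_ [psi lin_psi <-] <-]].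
    have [tau tau_sec tau_coc] :=
      ext_equiv_section (ext_equiv_sym EE') sec' coc'.
    (* Two sections of E differ by a map into the kernel; it is the psi whose coboundary relates
       their cochains. *)
    have /choice[psi psiE] x : exists m, sigma x = ext_iota E m + tau x.
      by apply: ext_pi_inj; rewrite (proj2 sec) (proj2 tau_sec).
    have lin_psi : linear psi.
      move=> a x y; apply: (@ext_iota_inj _ _ _ _ _ E).
      apply: (addIr (tau (a *: x + y))); rewrite -psiE (proj1 sec).
      by rewrite (proj1 tau_sec) linearP /= addrACA -scalerDr -!psiE.
    have [_ coc2] := ext_cochain_change charFp h_sab sec coc lin_psi.
    exists (delta1 rho psi); first by exists psi.
    have tauE : (fun x => sigma x - ext_iota E (psi x)) = tau.
      by apply/funext => x; rewrite psiE addrAC subrr add0r.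
    by rewrite tauE in coc2; exact: cochain_eq coc2 tau_coc.
  have [sec2 coc2] := ext_cochain_change charFp h_sab sec coc lin_psi.
  exists E, (fun x => sigma x - ext_iota E (psi x)); split=> //.
  exact: ext_equiv_refl.
have class_has_cochain (E : extension rho) : exists sigma : g -> E, exists c,
    ext_section sigma /\ ext_cochain sigma c.
  have [sigma sec] := ext_section_exists E; have [c coc] := cochain_exists sec.
  by exists sigma, c.
exists Phi; split; last first.
  move=> E sigma sec; have [c coc] := cochain_exists sec.
  by exists c => //; exact: PhiE sec coc.
split.
- move=> _ [E _ <-]; have [sigma [c [sec coc]]] := class_has_cochain E.
  rewrite (PhiE _ _ _ sec coc); exists c => //.
  exact: (ext_cochain_Z2 sec coc).
(* Injectivity: a cochain of E lies in the image of the class of E', hence is also the cochain of a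
   section of some extension equivalent to E'. *)
- move=> _ _ /set_mem[E _ <-] /set_mem[E' _ <-] eqPhi.
  have [sigma [c [sec coc]]] := class_has_cochain E.
  have : Phi (ext_class E) c.
    by exists E, sigma; split=> //; exact: ext_equiv_refl.
  rewrite eqPhi => -[E'' [sigma'' [E'E'' sec'' coc'']]].
  apply: ext_class_eq; apply: ext_equiv_trans (ext_equiv_sym E'E'').
  exact: ext_cochain_equiv sec sec'' coc coc''.
(* Surjectivity: the section x -> (0, x) of the twisted extension has cochain exactly c. *)
- move=> _ [c Hc <-]; exists (ext_class (twisted_extension charFp h_sab Hc)).
    by exists (twisted_extension charFp h_sab Hc).
  by have [sec coc] := twisted_sectionP charFp h_sab Hc; exact: PhiE sec coc.
Qed.
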